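(* Let $V$ be a countable subset of $\mathbb{R}_+$ containing $0$ and satisfying the four-values condition. If for some $r>0$ the set $V\cap[0,r]$ is dense in $[0,r]$, then the Urysohn space $\mathbb{U}_V$ with spectrum $V$ is divisible.
   Context: $\mathbb{R}_+$ is the set of non-negative reals. For $u_1,u_2,u_1',u_2'\in V$ let $\phi(u_1,u_2,u_1',u_2'):=[\max\{|u_1-u_2|,|u_1'-u_2'|\},\ \min\{u_1+u_2,u_1'+u_2'\}]$ and say that $\rho_V(u_1,u_2,u_1',u_2')$ holds if $\phi(u_1,u_2,u_1',u_2')\cap V\neq\emptyset$. $V$ satisfies the four-values condition if for all $u_1,u_2,u_1',u_2'\in V$, $\rho_V(u_1,u_2,u_1',u_2')$ implies $\rho_V(u_1,u_1',u_2,u_2')$. The spectrum of a metric space $(M;d)$ is $\{d(x,y): x,y\in M\}$. The age of a metric space is the class of all finite metric spaces that embed isometrically into it. A metric space is homogeneous if every isometry between two of its finite subspaces extends to an isometry of the space onto itself. $\mathcal{M}_{V,<\omega}$ is the class of finite metric spaces whose spectrum is included in $V$. When $V$ is countable and satisfies the four-values condition there is a countable homogeneous metric space, unique up to isometry, whose age is $\mathcal{M}_{V,<\omega}$; it is denoted $\mathbb{U}_V$ and called the Urysohn space with spectrum $V$. A metric space $\mathbb{M}=(M;d)$ is divisible if there is a partition of $M$ into two parts, neither of which contains an isometric copy of $\mathbb{M}$. *)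

(* Defs.v *)
From HB Require Import structures.
From mathcomp Require Import all_boot all_order all_algebra.
From mathcomp Require Import all_classical all_reals all_analysis.

Set Implicit Arguments.
Unset Strict Implicit.
Unset Printing Implicit Defensive.

Import Order.TTheory GRing.Theory Num.Theory.
Import numFieldNormedType.Exports.

Local Open Scope classical_set_scope.
Local Open Scope ring_scope.

Definition phi (R : realType) (u1 u2 u1' u2' : R) : set R :=
  `[Num.max `|u1 - u2| `|u1' - u2'|, Num.min (u1 + u2) (u1' + u2')]%classic.

Definition rho (R : realType) (V : set R) (u1 u2 u1' u2' : R) : Prop :=
  phi u1 u2 u1' u2' `&` V !=set0.

Definition four_values (R : realType) (V : set R) : Prop :=
  forall u1 u2 u1' u2', V u1 -> V u2 -> V u1' -> V u2' ->
    rho V u1 u2 u1' u2' -> rho V u1 u1' u2 u2'.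

Definition dense_in (T : topologicalType) (A D : set T) : Prop :=
  D `<=` A /\ A `<=` closure D.

Definition spectrum (R : realType) (M : metricType R) : set R :=
  [set mdist xy.1 xy.2 | xy in [set: M * M]].

Definition isometric_embedding (R : realType) (N M : metricType R)
    (f : N -> M) : Prop :=
  forall x y, mdist (f x) (f y) = mdist x y.

(* The empty space counts as a finite metric space in both classes below. *)
Definition in_age (R : realType) (M F : metricType R) : Prop :=
  finite_set [set: F] /\ exists f : F -> M, isometric_embedding f.

Definition in_finite_metric_class (R : realType) (V : set R)
    (F : metricType R) : Prop :=
  finite_set [set: F] /\ spectrum F `<=` V.

(* An isometry between the subspaces A and B is given by a function on all
   of M of which only the values on A matter. *)
Definition homogeneous (R : realType) (M : metricType R) : Prop :=
  forall (A B : set M) (f : M -> M),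
    finite_set A -> finite_set B -> set_bij A B f ->
    (forall x y, A x -> A y -> mdist (f x) (f y) = mdist x y) ->
  exists g : M -> M,
    [/\ isometric_embedding g, set_bij setT setT g &
        forall x, A x -> g x = f x].

(* These conditions determine M up to isometry, so a statement about the
   Urysohn space with spectrum V is one about every M satisfying them. *)
Definition is_urysohn (R : realType) (V : set R) (M : metricType R) : Prop :=
  [/\ countable [set: M], homogeneous M &
      forall F : metricType R, in_age M F <-> in_finite_metric_class V F].

Definition contains_copy (R : realType) (M : metricType R) (A : set M) : Prop :=
  exists f : M -> M, isometric_embedding f /\ range f `<=` A.

(* Both parts are automatically nonempty: the complement of an empty part
   would be the whole space, which contains a copy of itself. *)
Definition divisible (R : realType) (M : metricType R) : Prop :=
  exists A B : set M,
    [/\ A `|` B = setT, A `&` B = set0, ~ contains_copy A & ~ contains_copy B].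

(* Main.v *)
Require Import Defs.
From HB Require Import structures.
From mathcomp Require Import all_boot all_order all_algebra.
From mathcomp Require Import all_classical all_reals all_analysis.
From mathcomp Require Import lra.
Import Order.TTheory GRing.Theory Num.Theory.
Import numFieldNormedType.Exports.
Local Open Scope classical_set_scope.
Local Open Scope ring_scope.

(** If the small values of V are dense, then between two points of U at small
    distance there are chains of arbitrarily small steps.  A countable metric
    space with enough such chains is divisible, for the following reason.

    Fix a radius rho such that every point is linked by fine chains to a point
    at distance at least 2 rho.  Rank the points by an injection into the
    natural numbers and assign to each point y its center: the point of least
    rank in the open ball of radius rho around y.  Cut each ball into
    concentric rings whose radii accumulate at rho, and colour y by the parity
    of the index of the ring that contains it in the ball around its center.
    Let a copy f of the space be given, and let x be the center of least rank
    among all centers of points of the copy.  By minimality x is the center of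
    every point of the copy that lies in the ball around x.  The copy has a
    point in that ball and also a point outside it, joined to the first by
    fine chains.  Such chains cannot jump over a ring, so they meet every ring
    that is close enough to the boundary ([chain_linked_crosses_ring]); hence
    the copy takes both colours ([divisible_of_far_chain_linked]).

    The chains come from the one-point extension property of U
    ([one_point_extension]).  Given p and q, a triangle with sides d(p, q),
    delta and t, where delta is small and t is slightly smaller than d(p, q),
    yields a point z with d(p, z) = delta and d(z, q) = t; repeating this
    brings the first point close to q ([chain_linked_of_dense]). *)

Set Implicit Arguments.
Unset Strict Implicit.

(** This says that for every e > 0 a finite chain of steps shorter than e leads
    from p to q.  Quantifying over the sets closed under such steps, instead of
    over chains, lets each use choose an invariant of the chain. *)
Definition chain_linked (R : realType) (M : metricType R) (p q : M) : Prop :=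
  forall (e : R) (P : set M), 0 < e -> P p ->
    (forall x y, P x -> mdist x y < e -> P y) -> P q.

Lemma exists_first_near (R : realType) (M : metricType R) (rank : M -> nat)
    (rho : R) (y : M) : 0 < rho ->
  exists x, mdist x y < rho /\
    forall x', mdist x' y < rho -> (rank x <= rank x')%N.
Proof.
move=> rho_gt0.
pose near_rank n := `[< exists2 x, mdist x y < rho & rank x = n >].
have : exists n, near_rank n.
  by exists (rank y); apply/asboolP; exists y; rewrite ?mdistxx.
case/ex_minnP => n /asboolP[x xy <-] n_min; exists x; split=> // x' x'y.
by apply: n_min; apply/asboolP; exists x'.
Qed.

(** The points whose distance t to x satisfies truncn (1 / (rho - t)) = k + 1
    form a ring, of inner radius rho - 1 / (k + 1) and outer radius
    rho - 1 / (k + 2).  A chain whose steps are shorter than the difference of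
    the two radii stays inside the inner radius if it misses the ring. *)
Lemma chain_linked_crosses_ring (R : realType) (M N : metricType R)
    (f : N -> M) (x : M) (rho : R) (k : nat) (p q : N) :
  isometric_embedding f -> chain_linked p q ->
  mdist x (f p) < rho - k.+1%:R^-1 -> rho <= mdist x (f q) ->
  exists2 z, mdist x (f z) < rho &
    Num.truncn (rho - mdist x (f z))^-1 = k.+1.
Proof.
move=> fisom pq; set a := k.+1%:R^-1; pose b : R := k.+2%:R^-1.
move=> xp xq; apply: contrapT => no_z.
have b_gt0 : 0 < b by rewrite invr_gt0 ltr0n.
have ba : b < a by rewrite ltf_pV2 ?posrE ?ltr0n// ltr_nat.
suff : mdist x (f q) < rho - a by lra.
apply: (pq (a - b) [set z | mdist x (f z) < rho - a]).
- lra.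
- exact: xp.
move=> y z /= xy yz; have := metric_triangle x (f y) (f z).
rewrite fisom => tri; rewrite ltNge; apply/negP => xz.
have xz_lt : mdist x (f z) < rho - b by lra.
apply: no_z; exists z; first by lra.
have gap_gt0 : 0 < rho - mdist x (f z) by lra.
apply/eqP; rewrite truncn_eq ?invr_ge0 ?(ltW gap_gt0)//.
rewrite -[k.+1%:R]invrK -[k.+2%:R]invrK -/a -/b.
rewrite lef_pV2 ?ltf_pV2 ?posrE//; last by lra.
by apply/andP; split; lra.
Qed.

(** Countability supplies the well-ordering that picks the centers; the
    hypothesis on far points makes every copy leave each ball of radius
    s / 2. *)
Lemma divisible_of_far_chain_linked (R : realType) (M : metricType R) (s : R) :
  countable [set: M] -> 0 < s -> [set: M] !=set0 ->
  (forall p : M, exists2 q, s <= mdist p q & chain_linked p q) ->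
  divisible M.
Proof.
move=> /countable_injP[rank rank_inj] s_gt0 [p0 _] far.
have {}rank_inj : injective rank by move=> x y; apply: rank_inj; rewrite inE.
pose rho := s / 2; have rho_gt0 : 0 < rho by rewrite divr_gt0.
have [center centerP] :=
  choice (fun y => exists_first_near rank y rho_gt0).
pose colour y := odd (Num.truncn (rho - mdist (center y) y)^-1).
have no_copy b : ~ contains_copy [set y | colour y = b].
  move=> [f [fisom fb]].
  (* The point p of the copy is chosen so that its center has least rank. *)
  have : exists n, `[< exists p, rank (center (f p)) = n >].
    by exists (rank (center (f p0))); apply/asboolP; exists p0.
  case/ex_minnP => n /asboolP[p <-] p_min.
  pose x := center (f p).
  have xp : mdist x (f p) < rho by have [] := centerP (f p).
  have center_x z : mdist x (f z) < rho -> center (f z) = x.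
    move=> xz; have [_ first_z] := centerP (f z).
    apply/rank_inj/eqP; rewrite eqn_leq first_z//=.
    by apply: p_min; apply/asboolP; exists z.
  have [q pq_far pq] := far p.
  have xq : rho <= mdist x (f q).
    have := metric_triangle (f p) x (f q).
    by rewrite fisom (metric_sym (f p) x); move: xp; rewrite /rho; lra.
  (* Of the ring after the one of f p and the next ring, one has the other
     colour. *)
  have [k k_odd k_big] : exists2 k, odd k.+1 = ~~ b &
      mdist x (f p) < rho - k.+1%:R^-1.
    pose m := Num.truncn (rho - mdist x (f p))^-1.
    have gap_gt0 : 0 < rho - mdist x (f p) by rewrite subr_gt0.
    have big k : (m <= k)%N -> mdist x (f p) < rho - k.+1%:R^-1.
      move=> mk; rewrite ltrBrDl -ltrBrDr invf_plt ?posrE ?ltr0n//.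
      apply: (@lt_le_trans _ _ m.+1%:R); last by rewrite ler_nat.
      by have /andP[] := truncn_itv (ltW (etrans (invr_gt0 _) gap_gt0)).
    have [mb|mb] := eqVneq (odd m.+1) (~~ b).
      by exists m => //; exact: big.
    exists m.+1; last exact: big.
    by move: mb; rewrite /=; case: (odd m); case: b {fb}.
  have [z xz zk] := chain_linked_crosses_ring fisom pq k_big xq.
  have : colour (f z) = b by apply: fb; exists z.
  by rewrite /colour center_x// zk k_odd; case: (b).
exists [set y | colour y = true], [set y | colour y = false]; split=> //.
- by apply/seteqP; split=> // y _ /=; case: (colour y); [left|right].
- by apply/seteqP; split=> // y [/= ->].
Qed.

(** Adding to A a point at distance g x from each x gives a finite metric space
    with values in V, which therefore embeds into U.  Homogeneity moves its
    copy of A back onto A, and the added point goes along. *)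
Lemma one_point_extension (R : realType) (V : set R) (U : metricType R)
    (A : set U) (g : U -> R) :
  is_urysohn V U -> V 0 -> finite_set A ->
  (forall x y, A x -> A y -> V (mdist x y)) ->
  (forall x, A x -> V (g x)) -> (forall x, A x -> 0 < g x) ->
  (forall x y, A x -> A y -> g x <= mdist x y + g y) ->
  (forall x y, A x -> A y -> mdist x y <= g x + g y) ->
  exists z, forall x, A x -> mdist x z = g x.
Proof.
move=> [_ homU ageU] V0 finA VA Vg g_gt0 g_lip g_kat.
pose T := option (set_type A).
pose d (u v : T) : R := match u, v with
  | Some a, Some b => mdist (val a) (val b)
  | Some a, None | None, Some a => g (val a)
  | None, None => 0
  end.
have inA (a : set_type A) : A (val a) by exact: set_valP.
have dxx u : d u u = 0 by case: u => //= a; exact: mdistxx.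
have d0_eq u v : d u v = 0 -> u = v.
  case: u v => [a|] [b|] //=.
  - by move/mdist_positivity/val_inj => ->.
  - by move=> g0; have := g_gt0 (val a) (inA a); rewrite g0 ltxx.
  - by move=> g0; have := g_gt0 _ (inA b); rewrite g0 ltxx.
have d_sym u v : d u v = d v u.
  by case: u v => [a|] [b|] //=; exact: metric_sym.
have d_tri v u w : d u w <= d u v + d v w.
  case: u v w => [a|] [b|] [c|] //=; rewrite ?addr0 ?add0r//.
  - exact: metric_triangle.
  - exact: g_lip (inA a) (inA b).
  - exact: g_kat (inA a) (inA c).
  - by rewrite addrC metric_sym; exact: g_lip (inA c) (inA b).
  - by rewrite addr_ge0 ?ltW ?(g_gt0 _ (inA b)).
pose F : metricType R := HB.pack T (isMetric.Build R T dxx d0_eq d_sym d_tri).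
have [phi phi_isom] : exists phi : F -> U, isometric_embedding phi.
  suff /ageU[] : in_finite_metric_class V F by [].
  split; last first.
    move=> _ [[u v] _ <-] /=; rewrite [mdist _ _]/=.
    case: u v => [a|] [b|] //=; [exact: VA|exact: Vg|exact: Vg].
  have finS : finite_set [set: set_type A].
    have -> : [set: set_type A] = val @^-1` A.
      by apply/seteqP; split=> // a _; exact: inA.
    by apply: finite_preimage => // a b _ _; exact: val_inj.
  have -> : [set: F] = [set None] `|` (Some @` [set: set_type A]).
    by apply/seteqP; split=> // -[a|] _; [right; exists a|left].
  by rewrite finite_setU; split; [exact: finite_set1|exact: finite_image].
(* [k] sends A onto its copy inside [phi F]; only its values on A matter. *)
pose k x := if pselect (A x) is left Ax
  then phi (Some (SigSub (mem_set Ax))) else x.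
have kE (a : set_type A) : k (val a) = phi (Some a).
  rewrite /k; case: pselect => [Ax|/(_ (inA a))//].
  by congr (phi (Some _)); exact: val_inj.
have k_onA x : A x -> exists2 a : set_type A, x = val a & k x = phi (Some a).
  by move=> Ax; exists (SigSub (mem_set Ax)) => //; rewrite -kE.
have k_isom x y : A x -> A y -> mdist (k x) (k y) = mdist x y.
  by move=> /k_onA[a -> ->] /k_onA[b -> ->]; rewrite phi_isom.
have [h [h_isom [_ _ h_surj] hk]] : exists h : U -> U,
    [/\ isometric_embedding h, set_bij setT setT h &
        forall x, A x -> h x = k x].
  apply: (homU A (k @` A) k) => //; first exact: finite_image.
  split=> [x Ax|x y /set_mem Ax /set_mem Ay kxy|//]; first by exists x.
  by apply: mdist_positivity; rewrite -k_isom// kxy mdistxx.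
have [z _ hz] := h_surj (phi None) I.
exists z => x Ax; rewrite -h_isom hz hk//.
by have [a -> ->] := k_onA _ Ax; rewrite phi_isom.
Qed.

Lemma dense_in_itv_between (R : realType) (V : set R) (r a b : R) :
  dense_in `[0, r] (V `&` `[0, r]) -> 0 <= a -> a < b -> b <= r ->
  exists2 v, V v & a < v < b.
Proof.
move=> [_ rV] a_ge0 ab br.
have mid : closure (V `&` `[0, r]) ((a + b) / 2).
  by apply: rV; rewrite /= in_itv/=; lra.
have [|v [[Vv _] abv]] := mid `]a, b[%classic.
  by apply: near_in_itvoo; rewrite in_itv/=; lra.
by exists v => //; move: abv; rewrite /= in_itv.
Qed.

(** Each step of length delta < e shortens the distance to q by more than
    delta / 2, so after finitely many steps it is below e, and a last step
    reaches q. *)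
Lemma chain_linked_of_dense (R : realType) (V : set R) (U : metricType R)
    (r : R) (p q : U) :
  is_urysohn V U -> V 0 -> 0 < r -> dense_in `[0, r] (V `&` `[0, r]) ->
  V (mdist p q) -> mdist p q <= r -> chain_linked p q.
Proof.
move=> hU V0 r_gt0 Vdense Vpq pqr e P e_gt0 Pp P_step.
have [delta Vdelta /andP[delta_gt0]] : exists2 v, V v & 0 < v < Num.min e r.
  apply: (dense_in_itv_between Vdense) => //; first by rewrite lt_min e_gt0.
  by rewrite ge_min lexx orbT.
rewrite lt_min => /andP[delta_e delta_r].
have [n] : exists n : nat, mdist p q < n%:R * (delta / 2).
  exists (Num.truncn (mdist p q / (delta / 2))).+1.
  by rewrite -ltr_pdivrMr ?divr_gt0// truncnS_gt.
elim: n p Vpq pqr Pp => [|n IHn] p Vpq pqr Pp pqn.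
  by move: pqn; rewrite mul0r ltNge mdist_ge0.
have [|pq_e] := ltP (mdist p q) e; first exact: P_step.
have [t Vt /andP[t_gt t_lt]] :
    exists2 v, V v & mdist p q - delta < v < mdist p q - delta / 2.
  by apply: (dense_in_itv_between Vdense); lra.
have q_neq_p : q != p.
  by apply/eqP => qp; move: pq_e; rewrite qp mdistxx leNgt e_gt0.
pose g x := if x == p then delta else t.
have gp : g p = delta by rewrite /g eqxx.
have gq : g q = t by rewrite /g (negbTE q_neq_p).
have [z gz] : exists z, forall x, [set p; q] x -> mdist x z = g x.
  apply: (one_point_extension hU V0).
  - exact: finite_set2.
  - by move=> x y [->|->] [->|->]; rewrite ?mdistxx// metric_sym.
  - by move=> x [->|->]; rewrite ?gp ?gq.
  - by move=> x [->|->]; rewrite ?gp ?gq; lra.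
  - by move=> x y [->|->] [->|->];
      rewrite ?(metric_sym q p) ?mdistxx ?gp ?gq; lra.
  - by move=> x y [->|->] [->|->];
      rewrite ?(metric_sym q p) ?mdistxx ?gp ?gq; lra.
have pz : mdist p z = delta by rewrite gz ?gp//; left.
have zq : mdist z q = t by rewrite metric_sym gz ?gq//; right.
apply: (IHn z); rewrite ?zq//.
- lra.
- by apply: P_step Pp _; rewrite pz.
- by move: pqn; rewrite -natr1; lra.
Qed.

Unset Implicit Arguments.

Theorem theorem4p4 (R : realType) (V : set R)
    (V_ge0 : V `<=` [set x | 0 <= x]) (V_countable : countable V)
    (V0 : V 0) (V_four_values : four_values V)
    (V_dense : exists r : R, 0 < r /\ dense_in `[0, r] (V `&` `[0, r]))
    (U : metricType R) (hU : is_urysohn V U) :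
  divisible U.
Proof.
have [r [r_gt0 Vdense]] := V_dense.
have [s Vs /andP[s_gt0 s_r]] : exists2 v, V v & 0 < v < r.
  exact: (dense_in_itv_between Vdense).
have [U_countable _ _] := hU.
apply: (@divisible_of_far_chain_linked _ _ s) => //.
  (* The extension of the empty set by a point shows that U is nonempty. *)
  have [z _] := one_point_extension (g := fun=> 0) hU V0 (@finite_set0 U)
    ltac:(by []) ltac:(by []) ltac:(by []) ltac:(by []) ltac:(by []).
  by exists z.
move=> p.
have [q pq] : exists z, forall x, [set p] x -> mdist x z = s.
  apply: (one_point_extension (g := fun=> s) hU V0).
  - exact: finite_set1.
  - by move=> x y -> ->; rewrite mdistxx.
  - by [].
  - by [].
  - by move=> x y -> ->; rewrite mdistxx add0r.
  - by move=> x y -> ->; rewrite mdistxx addr_ge0// ltW.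
have {}pq : mdist p q = s by exact: pq.
exists q; first by rewrite pq.
by apply: (chain_linked_of_dense hU V0 r_gt0 Vdense); rewrite pq// ltW.
Qed.
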